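(* Let $(M,g)$ be a Riemannian manifold of dimension $n\ge 4$, let $h$ be a smooth function on $M$, and let $V$ be a Lipschitz function on $M$ with $0<a\le V(x)\le b<+\infty$ for all $x\in M$ and $\|\nabla V\|_\infty\le A$. Let $(u_k)_{k\in\mathbb N}$ be a sequence of regular solutions on $M$ of $$\Delta u+hu=Vu^{(n+2)/(n-2)},\qquad u>0. \qquad (E)$$ Let $\mathcal K$ be one of the families of compact subsets of $M$ described in the context. Then at least one of the following holds. 1) There exist $K_0\in\mathcal K$, a subsequence $(u_{i_j})_j$ of $(u_k)$ and a constant $C>0$ such that $$\sup_{K_0}u_{i_j}\le C\qquad\text{for all } j.$$ 2) For every $K\in\mathcal K$ one has $\sup_K u_k\to+\infty$ as $k\to+\infty$, and moreover: (i) if $n=4$, then for every $\epsilon>0$ there is a positive function $c=c(a,b,A,\cdot,K,M,g)$ such that, for all $K\in\mathcal K$ and all $k$, $$\Big(\sup_K u_k\Big)^{1-\epsilon}\le c\Big(a,b,A,\frac{\inf_M u_k}{(\sup_K u_k)^{\epsilon}},K,M,g\Big);$$ (ii) if $n\ge5$, then for every $\epsilon>\frac{n-4}{n-2}$ there is a positive function $c=c(a,b,A,n,\cdot,K,M,g)$ such that for every $K\in\mathcal K$ there is a sequence of numbers $\epsilon_k=\epsilon_k(K)$ with $0<\epsilon_k\le1$ such that, for all $k$, $$\Big(\sup_K u_k\Big)^{1-\epsilon}\le \epsilon_k^{1-\epsilon}\,c\Big(a,b,A,n,\epsilon_k^{\epsilon}\,\frac{\inf_M u_k}{(\sup_K 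u_k)^{\epsilon}},K,M,g\Big).$$
   Context: $\Delta=-\nabla^i\nabla_i$ denotes the Laplace–Beltrami operator of $(M,g)$ with the nonnegative sign convention. ''Regular solution'' means a classical (at least $C^2$) positive solution on $M$. The family $\mathcal K$ is either $\mathcal K=\{K\subset M \text{ compact}: \operatorname{int}K\neq\emptyset\}$, or, for a fixed $x_0\in M$, $\mathcal K=\mathcal K_{x_0}=\{\bar B_r(x_0): 0<r<\operatorname{inj}(x_0)/2\}$, where $\operatorname{inj}(x_0)$ is the injectivity radius at $x_0$ and balls are taken for the Riemannian distance of $M$. The function $c$ is a function, with values in $(0,+\infty)$, of a positive real variable (the fifth-from-last type argument written as a dot above, into which the ratio involving $\inf_M u_k$ is inserted) and of $K\in\mathcal K$. It may depend on the indicated data, on $\epsilon$, and on the given sequence $(u_k)$, but not on the index $k$. The inequalities in 2) are understood for indices $k$ with $\inf_M u_k>0$, so that the variable is a positive number. *)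

(* Defs.v *)
From HB Require Import structures.
From mathcomp Require Import all_boot all_order all_algebra.
From mathcomp Require Import all_classical all_reals all_analysis.
Set Implicit Arguments.
Unset Strict Implicit.
Unset Printing Implicit Defensive.
Import Order.TTheory GRing.Theory Num.Theory.
Import numFieldNormedType.Exports.
Local Open Scope classical_set_scope.
Local Open Scope ring_scope.

Section Euclidean.
Variables (R : realType) (n : nat).
Implicit Types (A : set 'rV[R]_n) (f : 'rV[R]_n -> R).

Definition partial (i : 'I_n) f : 'rV[R]_n -> R :=
  fun y => 'D_(delta_mx 0 i) f y.

(* Meant for open [A]: only then do the partial derivatives at the points of
   [A] depend on the restriction of [f] to [A] alone. *)
Fixpoint Ck_on (k : nat) A f : Prop :=
  (forall y, A y -> {for y, continuous f}) /\
  if k is k'.+1 then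
    forall i, (forall y, A y -> derivable f y (delta_mx 0 i)) /\
              Ck_on k' A (partial i f)
  else True.

Definition smooth_on A f : Prop := forall k, Ck_on k A f.

(* Lebesgue-null sets of R^n, as the library has no Lebesgue measure on R^n:
   coverable by countably many boxes of arbitrarily small total volume. *)
Definition lebesgue_null A : Prop :=
  forall e : R, 0 < e -> exists lo hi : nat -> 'rV[R]_n,
    [/\ forall m i, lo m 0 i <= hi m 0 i,
        A `<=` \bigcup_m [set y | forall i, lo m 0 i <= y 0 i <= hi m 0 i] &
        (\sum_(0 <= m <oo) (\prod_i (hi m 0 i - lo m 0 i))%:E <= e%:E)%E].

End Euclidean.

Record chart (R : realType) (n : nat) (T : topologicalType) := Chart {
  cdom : set T;
  cimg : set 'rV[R]_n;
  cmap : T -> 'rV[R]_n;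
  cinv : 'rV[R]_n -> T;
  cdom_open : open cdom;
  cimg_open : open cimg;
  cmap_img : forall x, cdom x -> cimg (cmap x);
  cinv_dom : forall y, cimg y -> cdom (cinv y);
  cmapK : forall x, cdom x -> cinv (cmap x) = x;
  cinvK : forall y, cimg y -> cmap (cinv y) = y;
  cmap_cont : forall x, cdom x -> {for x, continuous cmap};
  cinv_cont : forall y, cimg y -> {for y, continuous cinv}
}.

(* The atlas is not required to be maximal. *)
Record manifold (R : realType) (n : nat) := Manifold {
  carrier :> topologicalType;
  manifold_hausdorff : hausdorff_space carrier;
  manifold_second_countable : @second_countable carrier;
  atlas : set (chart R n carrier);
  atlas_cover : forall x, exists2 c, atlas c & cdom c x;
  atlas_smooth : forall c c', atlas c -> atlas c' -> forall i,
    smooth_on (cimg c `&` cinv c @^-1` cdom c')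
              (fun y => cmap c' (cinv c y) 0 i)
}.

(* [gmx c y] is the matrix (g_ij) at the point of coordinates [y] in [c].
   Tangent vectors are rows, so that ['J f y] acts on them on the right. *)
Record metric (R : realType) (n : nat) (M : manifold R n) := Metric {
  gmx : chart R n M -> 'rV[R]_n -> 'M[R]_n;
  gmx_smooth : forall c, atlas c -> forall i j,
    smooth_on (cimg c) (fun y => gmx c y i j);
  gmx_sym : forall c y, atlas c -> cimg c y -> (gmx c y)^T = gmx c y;
  gmx_pos : forall c y, atlas c -> cimg c y ->
    forall v : 'rV[R]_n, v != 0 -> 0 < (v *m gmx c y *m v^T) 0 0;
  gmx_compat : forall c c' y, atlas c -> atlas c' -> cimg c y ->
    cdom c' (cinv c y) ->
    let tau := cmap c' \o cinv c in
    gmx c y = 'J tau y *m gmx c' (tau y) *m ('J tau y)^T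
}.

Section Riemannian.
Variables (R : realType) (n : nat) (M : manifold R n) (g : metric M).
Implicit Types (c : chart R n M) (x y z : M) (f h V u : M -> R).

Definition Ck_fun (k : nat) f : Prop :=
  forall c, atlas c -> Ck_on k (cimg c) (f \o cinv c).

Definition smooth_fun f : Prop := forall k, Ck_fun k f.

Definition ginv c (p : 'rV[R]_n) : 'M[R]_n := invmx (gmx g c p).

Definition christoffel c (p : 'rV[R]_n) (k i j : 'I_n) : R :=
  2^-1 * \sum_l ginv c p k l *
    (partial i (fun q => gmx g c q j l) p + partial j (fun q => gmx g c q i l) p
     - partial l (fun q => gmx g c q i j) p).

(* - nabla^i nabla_i f at [x], computed in the chart [c] around [x]; the value
   does not depend on [c]. *)
Definition laplacian c f x : R :=
  let F := f \o cinv c in let p := cmap c x in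
  - \sum_i \sum_j ginv c p i j *
      (partial i (partial j F) p - \sum_k christoffel c p k i j * partial k F p).

Definition gradient_norm c f (p : 'rV[R]_n) : R :=
  let F := f \o cinv c in
  Num.sqrt (\sum_i \sum_j ginv c p i j * partial i F p * partial j F p).

Definition gradient_bounded (A : R) f : Prop :=
  forall c, atlas c ->
    lebesgue_null [set p | cimg c p /\
      ~ (differentiable (f \o cinv c) p /\ gradient_norm c f p <= A)].

Definition tangent_norm c (p v : 'rV[R]_n) : R :=
  Num.sqrt ((v *m gmx g c p *m v^T) 0 0).

(* Lengths of piecewise C^1 curves, each curve being subdivided into
   C^1 pieces [s : [0, 1] -> M] contained in the domain of one chart and
   written in the coordinates of that chart. *)
Inductive curve_length : M -> M -> \bar R -> Prop :=
| curve_nil x : curve_length x x 0%E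
| curve_cons c (s : R -> 'rV[R]_n) z l :
    atlas c ->
    (forall t, derivable s t 1) -> continuous (derive1 s) ->
    (forall t, 0 <= t <= 1 -> cimg c (s t)) ->
    curve_length (cinv c (s 1)) z l ->
    curve_length (cinv c (s 0)) z
      (\int[lebesgue_measure]_(t in `[0%R, 1%R])
         (tangent_norm c (s t) (derive1 s t))%:E + l)%E.

(* +oo between distinct connected components *)
Definition dist x y : \bar R := ereal_inf [set l | curve_length x y l].

(* [L > 0] is no restriction, and avoids 0 * +oo. *)
Definition lipschitz_fun f : Prop :=
  exists2 L : R, 0 < L &
    forall x y, (`|f x - f y|%:E <= L%:E * dist x y)%E.

(* geodesics defined on an open interval containing [0, 1] *)
Definition geodesic (gam : R -> M) : Prop :=
  exists2 d : R, 0 < d & forall t, - d < t < 1 + d ->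
    {for t, continuous gam} /\
    forall c, atlas c -> cdom c (gam t) ->
      let s := cmap c \o gam in
      [/\ derivable s t 1, derivable (derive1 s) t 1 &
          forall k, derive1 (derive1 s) t 0 k
            + \sum_i \sum_j christoffel c (s t) k i j
                            * derive1 s t 0 i * derive1 s t 0 j = 0].

(* The exponential map [E] at [x0] is defined on the ball of radius [r] centred
   at 0 in the tangent space at [x0] (identified with R^n by the chart [c0]),
   and is a diffeomorphism of that ball onto an open set, with inverse [F]. *)
Definition exp_diffeo (x0 : M) (r : R) : Prop :=
  exists2 c0, atlas c0 /\ cdom c0 x0 &
  let B := [set v | tangent_norm c0 (cmap c0 x0) v < r] in
  exists (E : 'rV[R]_n -> M) (F : M -> 'rV[R]_n),
    (forall v, B v -> exists gam : R -> M,
       [/\ geodesic gam, gam 0 = x0, derive1 (cmap c0 \o gam) 0 = v &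
           gam 1 = E v]) /\
    [/\ open (E @` B),
        forall v, B v -> F (E v) = v,
        forall v, B v -> {for v, continuous E},
        forall c, atlas c -> forall i,
          smooth_on (B `&` E @^-1` cdom c) (fun v => cmap c (E v) 0 i) &
        forall c, atlas c -> forall i,
          smooth_on (cimg c `&` cinv c @^-1` (E @` B))
                    (fun p => F (cinv c p) 0 i)].

Definition inj_radius (x0 : M) : \bar R :=
  ereal_sup [set r%:E | r in [set r : R | 0 < r /\ exp_diffeo x0 r]].

Definition closed_gball (x0 : M) (r : R) : set M :=
  [set x | (dist x0 x <= r%:E)%E].

Definition compact_family : set (set M) :=
  [set K | compact K /\ K° !=set0].

Definition ball_family (x0 : M) : set (set M) :=
  [set K | exists2 r : R, 0 < r /\ (r%:E < 2^-1%:E * inj_radius x0)%E &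
                          K = closed_gball x0 r].

Definition regular_solution h V u : Prop :=
  [/\ Ck_fun 2 u, forall x, 0 < u x &
      forall c x, atlas c -> cdom c x ->
        laplacian c u x + h x * u x
        = V x * u x `^ ((n%:R + 2) / (n%:R - 2))].

End Riemannian.

Section SupInf.
Variables (R : realType) (T : Type).

Definition esup_on (K : set T) (u : T -> R) : \bar R :=
  ereal_sup [set (u x)%:E | x in K].

Definition sup_on (K : set T) (u : T -> R) : R := fine (esup_on K u).

Definition inf_all (u : T -> R) : R := inf (range u).

End SupInf.

Arguments compact_family {R n} M.

(* Main.v *)
Require Import Defs.
From HB Require Import structures.
From mathcomp Require Import all_boot all_order all_algebra.
From mathcomp Require Import all_classical all_reals all_analysis.
From mathcomp Require Import ring lra.
Import Order.TTheory GRing.Theory Num.Theory.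
Import numFieldNormedType.Exports.
Local Open Scope classical_set_scope.
Local Open Scope ring_scope.

(** The heart of the matter is that the infima [inf_M u_k] are bounded by one
    constant, which comes from a single coordinate ball.  Where [u >= m > 0],
    a solution satisfies [Delta u >= (a m^(4/(n-2)) - h) u], so that [u] is a
    positive supersolution of a linear equation whose zeroth-order term is
    large when [m] is.  A positive supersolution on a fixed ball
    cannot tolerate this: it would push the first Dirichlet eigenvalue of
    the ball above any bound.  The quantitative form used here needs no
    spectral theory.  With [phi = r^2 - |y - p0|^2] in the chart, slide the
    graph of a multiple of the barrier [phi^2] up to [u]; at the point of
    first contact the gradients agree and the Hessians are ordered
    ([touching_conditions]), and ellipticity turns this into an inequality
    between the operator applied to [u] and to the barrier
    ([contraction_posdef_ge0]).  The square matters: on the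
    boundary of the ball, where [phi] vanishes, the second-order part of the
    operator applied to [phi^2] reduces to [2 |nabla phi|_g^2 > 0], so a
    compactness argument ([compact_penalization]) gives one constant that
    works up to the boundary ([positive_supersolution_bound],
    [inf_solution_bounded]).

    If the first alternative fails, then [sup_K u_k] tends to infinity for
    every [K].  Fix [e > 0], [K] and a value [t > 0] of the ratio
    [inf u_k / (sup_K u_k)^e].  An index [k] that realises [t] with a finite
    supremum has [sup_K u_k <= (C / t)^(1/e)], where [C] bounds the infima;
    as the suprema diverge, only finitely many such indices exist, and [c t K]
    can be any number above the finitely many values of [(sup_K u_k)^(1-e)]
    ([sup_bounded_by_ratio]).  This covers both dimension ranges, with
    [eps_k = 1] when [n >= 5], where [e > (n-4)/(n-2) >= 0]. *)

(** * Directional derivatives *)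

(** Transfers one-variable calculus (chain rule, mean value theorem) to
    directional derivatives. *)
Lemma is_derive_lineP (R : realType) (W : normedModType R) (f : W -> R)
    (p v : W) (t d : R) :
  is_derive (p + t *: v) v f d <-> is_derive t 1 (fun s => f (p + s *: v)) d.
Proof.
have E : (fun h : R => h^-1 *: ((f \o shift (p + t *: v)) (h *: v)
                                - f (p + t *: v)))
       = (fun h : R => h^-1 *: (((fun s => f (p + s *: v)) \o shift t)
                                  (h *: (1 : R)) - f (p + t *: v))).
  apply/funext => h /=; congr (_ *: (f _ - _)).
  by rewrite [h *: 1]mulr1 scalerDl addrCA.
by split=> -[D V]; split;
  move: D V; rewrite /derivable /derive /= ?E -?E.
Qed.

Lemma is_deriveZdir (R : realType) (W : normedModType R) (f : W -> R)
    (p v : W) (c d : R) :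
  is_derive p v f d -> is_derive p (c *: v) f (c * d).
Proof.
move=> fd; rewrite -[p in is_derive p](addr0 p) -(scale0r (c *: v)).
apply: (is_derive_lineP _ _ _ _ _ _ _).2.
have -> : (fun s => f (p + s *: (c *: v)))
    = (fun s => f (p + s *: v)) \o (fun s => s * c).
  by apply/funext => s /=; rewrite scalerA.
have dv : is_derive (0 * c) 1 (fun s => f (p + s *: v)) d.
  by rewrite mul0r; apply: (is_derive_lineP _ _ f p v 0 d).1; rewrite scale0r addr0.
rewrite mulrC; apply: (@is_derive1_comp _ _ (fun s => s * c) 0 d c dv).
apply: is_derive_eq.
by rewrite /GRing.scale /= mulr0 add0r mulr1.
Qed.

(** Directional derivatives are not additive in the direction in general.
    Splitting the increment along [v + w] into a step along [v] followed by a
    step along [w], the mean value theorem evaluates the second step at a nearby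
    point, and continuity of [dw] suffices to pass to the limit. *)
Lemma is_deriveDdir (R : realType) (W : normedModType R) (f : W -> R)
    (A : set W) (v w y : W) (dv : R) (dw : W -> R) :
  open A -> A y ->
  is_derive y v f dv -> (forall z, A z -> is_derive z w f (dw z)) ->
  {for y, continuous dw} ->
  is_derive y (v + w) f (dv + dw y).
Proof.
move=> oA Ay fv fw cw.
suff lim : h^-1 *: (f (h *: (v + w) + y) - f y) @[h --> 0^']
             --> dv + dw y.
  by apply: DeriveDef; [apply/cvg_ex; eexists; exact: lim | apply: cvg_lim].
have -> : (fun h : R => h^-1 *: (f (h *: (v + w) + y) - f y))
  = (fun h => h^-1 *: (f (h *: v + y) - f y)
              + h^-1 *: (f (h *: (v + w) + y) - f (h *: v + y))).
  apply/funext => h; rewrite -scalerDr; congr (_ *: _); lra.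
apply: cvgD; first by case: fv => D <-; exact: D.
apply/cvgrPdist_le => /= e e0.
have Ce : \forall z \near y, A z /\ `|dw y - dw z| <= e.
  apply: filterI; first exact: open_nbhs_nbhs.
  by move/cvgrPdist_le : cw; apply.
case/nbhs_normP : Ce => d /= d0 dA.
set N := `|v| + `|w| + 1.
have N0 : 0 < N by rewrite /N ltr_wpDl// addr_ge0.
near=> h.
have h0 : h != 0 by near: h; exact: nbhs_dnbhs_neq.
have hd : `|h| * N < d.
  rewrite -ltr_pdivlMr//; near: h; apply: dnbhs0_lt; exact: divr_gt0.
(* The whole segment travelled in the second step stays in the ball where
   [dw] is close to [dw y]. *)
have inB (t : R) : t \in `[0, 1] ->
    A (h *: v + y + t *: (h *: w)) /\
    `|dw y - dw (h *: v + y + t *: (h *: w))| <= e.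
  rewrite in_itv /= => /andP[t0 t1]; apply: dA => /=.
  have -> : y - (h *: v + y + t *: (h *: w)) = - (h *: v + t *: (h *: w)).
    by rewrite (addrC (h *: v)) -addrA opprD addNKr.
  rewrite normrN (le_lt_trans (ler_normD _ _))// !normrZ (ger0_norm t0).
  apply: le_lt_trans hd; rewrite /N mulrDr mulr1 mulrDr -addrA lerD2l.
  rewrite -[leLHS]addr0 lerD//.
  by rewrite ler_piMl// mulr_ge0.
have dl (t : R) : t \in `[0, 1] ->
    is_derive t 1 (fun s => f (h *: v + y + s *: (h *: w)))
                  (h * dw (h *: v + y + t *: (h *: w))).
  move=> /inB[At _]; apply: (is_derive_lineP _ _ f (h *: v + y) _ _ _).1; apply: is_deriveZdir.
  exact: fw.
pose phi (t : R) : R := f (h *: v + y + t *: (h *: w)).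
pose dphi (t : R) : R := h * dw (h *: v + y + t *: (h *: w)).
have dphiP (t : R) : t \in `]0, 1[ -> is_derive t 1 phi (dphi t).
  by move=> t01; apply: dl; exact: subset_itv_oo_cc t01.
have cphi : {within `[0, 1], continuous phi}.
  apply: continuous_in_subspaceT => t; rewrite inE /= => t01.
  have [D _] := dl t t01.
  exact/differentiable_continuous/derivable1_diffP.
have [c c01 Ef] := @MVT_segment R phi dphi 0 1 ler01 dphiP cphi.
move: Ef; rewrite /phi /dphi.
rewrite scale0r addr0 scale1r subr0 mulr1 => Ef.
have -> : h *: (v + w) + y = h *: v + y + h *: w.
  by rewrite scalerDr addrAC.
rewrite Ef /GRing.scale /= mulKf//.
exact: (inB c c01).2.
Unshelve. all: by end_near. Qed.

Lemma C1_directional_derivative (R : realType) (n : nat) (f : 'rV[R]_n -> R)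
    (A : set 'rV[R]_n) (v y : 'rV[R]_n) :
  open A -> Ck_on 1 A f -> A y ->
  is_derive y v f (\sum_i v 0 i * partial i f y).
Proof.
move=> oA [_ f1] Ay; rewrite {1}[v]row_sum_delta.
elim: (index_enum _) => [|i s IH].
  have := (is_derive_lineP _ _ f y (0 : 'rV[R]_n) 0 0).2.
  rewrite !big_nil scale0r addr0; apply.
  have -> : (fun s => f (y + s *: 0)) = cst (f y).
    by apply/funext => s /=; rewrite scaler0 addr0.
  exact: is_derive_cst.
rewrite !big_cons addrC [in X in is_derive _ _ _ X]addrC.
apply: (is_deriveDdir _ _ f A _ _ _ _ (fun z => v 0 i * partial i f z)) => //.
  move=> z Az; apply: is_deriveZdir.
  by apply/derivableP; apply: (f1 i).1.
by apply: continuousM; [exact: (@cst_continuous _ _ (v 0 i)) | exact: (f1 i).2.1].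
Qed.

(** If the second derivative were negative, the first one would be negative
    just to the right of 0, and the function would decrease below its
    minimum. *)
Lemma second_derivative_test_min (R : realType) (f df : R -> R) (d : R) :
  (\forall t \near (0 : R), is_derive (t : R) 1 f (df t)) ->
  is_derive (0 : R) 1 df d ->
  (\forall t \near (0 : R), f 0 <= f t) ->
  df 0 = 0 /\ 0 <= d.
Proof.
move=> fdf dfd fmin.
have /nbhs_normP[r /= r0 Br] : \forall t \near (0 : R),
    is_derive (t : R) 1 f (df t) /\ f 0 <= f t by exact: filterI.
have Br' (t : R) : `|t| < r -> is_derive t 1 f (df t) /\ f 0 <= f t.
  by move=> tr; apply: Br; rewrite /= sub0r normrN.
have df0 : df 0 = 0.
  have D0 : is_derive (0 : R) 1 f (df 0) by apply: (Br' 0 _).1; rewrite normr0.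
  have Nrr : - r <= r by rewrite ge0_cp// ltW.
  have E0 : is_derive (0 : R) 1 f 0.
    apply: (@derive1_at_min R f (- r) r 0 Nrr).
    - by move=> t; rewrite in_itv /= -ltr_norml => /Br'[[]].
    - by rewrite in_itv /= oppr_lt0 r0.
    - by move=> t; rewrite in_itv /= -ltr_norml => /Br'[].
  by case: D0 => _ <-; case: E0.
split=> //; rewrite leNgt; apply/negP => d0.
have quot : h^-1 *: (df (h *: 1 + 0) - df 0) @[h --> 0^'] --> d.
  by case: dfd => D <-; exact: D.
have /nbhs_normP[r1 /= r10 Br1] : \forall h \near 0^',
   h^-1 *: (df (h *: 1 + 0) - df 0) < 0 by exact: (cvgr_lt d).
have neg (h : R) : 0 < h -> h < r1 -> df h < 0.
  move=> h0 hr; have := Br1 h; rewrite /= sub0r normrN gtr0_norm// => /(_ hr).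
  move=> /(_ (lt0r_neq0 h0)); rewrite df0 subr0 addr0 [h *: 1]mulr1.
  by rewrite /GRing.scale /= pmulr_rlt0// invr_gt0.
pose t := Num.min r r1 / 2.
have m0 : 0 < Num.min r r1 by rewrite lt_min r0.
have t0 : 0 < t by rewrite divr_gt0.
have tm : t < Num.min r r1 by rewrite /t ltr_pdivrMr// ltr_pMr// ltr1n.
have /andP[tr tr1] : (t < r) && (t < r1) by rewrite -lt_min.
have small (s : R) : s \in `[0, t] -> `|s| < r.
  by rewrite in_itv /= => /andP[s0 st]; rewrite ger0_norm// (le_lt_trans st).
have df_in (s : R) : s \in `]0, t[ -> is_derive s 1 f (df s).
  by move=> s0t; apply: (Br' _ _).1; apply: small; exact: subset_itv_oo_cc s0t.
have cf : {within `[0, t], continuous f}.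
  apply: continuous_in_subspaceT => s; rewrite inE /= => /small/Br'[[D _] _].
  exact/differentiable_continuous/derivable1_diffP.
have [c] := @MVT R f df 0 t t0 df_in cf.
rewrite in_itv /= => /andP[c0 ct] Ec.
have : f 0 <= f t by apply: (Br' t _).2; rewrite gtr0_norm.
rewrite -subr_ge0 Ec subr0 pmulr_lge0// leNgt => /negP; apply.
by apply: neg => //; exact: lt_trans tr1.
Qed.

(** * Positive definite matrices *)

(** Completing the square in the first variable writes [P] as a rank-one
    matrix [x^T x / a] plus its Schur complement, positive definite of smaller
    size.  The rank-one part contributes the value of the quadratic form of [H]
    at [x], and induction deals with the rest. *)
Lemma trace_posdef_ge0 (R : realType) (n : nat) (P H : 'M[R]_n) :
  P^T = P -> (forall v : 'rV_n, v != 0 -> 0 < (v *m P *m v^T) 0 0) ->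
  (forall v : 'rV_n, 0 <= (v *m H *m v^T) 0 0) ->
  0 <= \tr (P *m H).
Proof.
elim: n P H => [|m IH] P H; first by rewrite /mxtrace big_ord0.
rewrite -[m.+1]/(1 + m)%N in P H *.
move=> Psym Ppos Hpos.
set b := ursubmx P; set Q := drsubmx P.
set a := ulsubmx P 0 0.
have EP : P = block_mx a%:M b b^T Q.
  by rewrite -[LHS]submxK -mx11_scalar /b trmx_ursub Psym.
have a0 : 0 < a.
  have := Ppos (row_mx 1 0).
  rewrite EP mul_row_block !mul0mx !addr0 !mul1mx tr_row_mx mul_row_col.
  rewrite trmx0 mulmx0 addr0 trmx1 mulmx1 mxE eqxx mulr1n; apply.
  by apply/eqP => /(congr1 lsubmx); rewrite row_mxKl linear0 => /eqP; rewrite oner_eq0.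
pose S : 'M[R]_m := Q - a^-1 *: (b^T *m b).
pose x : 'rV_(1 + m) := row_mx a%:M b.
have EPx : P = a^-1 *: (x^T *m x) + block_mx 0 0 0 S.
  rewrite EP /x tr_row_mx mul_col_row scale_block_mx add_block_mx !addr0.
  rewrite tr_scalar_mx mul_mx_scalar !mul_scalar_mx !scalerA mulVf ?gt_eqF// !scale1r.
  congr block_mx; last by rewrite /S addrC subrK.
  by rewrite mul_mx_scalar scalerA mulVf ?gt_eqF// scale1r.
have Qsym : Q^T = Q by rewrite /Q trmx_drsub Psym.
rewrite EPx mulmxDl mxtraceD addr_ge0//.
  rewrite -scalemxAl mxtraceZ mulr_ge0 ?invr_ge0 ?(ltW a0)//.
  by rewrite -mulmxA mxtrace_mulC trace_mx11; exact: Hpos.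
rewrite -[H]submxK mulmx_block !mul0mx !add0r mxtrace_block mxtrace0 add0r.
apply: IH => [|w w0|w].
- by rewrite /S linearB /= linearZ /= trmx_mul trmxK Qsym.
(* The Schur complement is [P] restricted to the vectors that are
   [P]-orthogonal to the first basis vector. *)
- pose v := row_mx (- a^-1 *: (w *m b^T)) w.
  have <- : v *m P *m v^T = w *m S *m w^T.
    rewrite EP mul_row_block tr_row_mx mul_row_col.
    rewrite mul_mx_scalar scalerA mulrN mulfV ?gt_eqF// scaleN1r addNr mul0mx add0r.
    congr (_ *m _); rewrite /S mulmxBr -scalemxAr -scalemxAl scaleNr addrC.
    by rewrite mulmxA.
  apply: Ppos.
  by apply: contra w0 => /eqP/(congr1 rsubmx); rewrite row_mxKr linear0 => ->.
- have := Hpos (row_mx 0 w); rewrite -[H in X in X -> _]submxK.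
  by rewrite mul_row_block tr_row_mx mul_row_col trmx0 mulmx0 mul0mx !add0r.
Qed.

Lemma contraction_posdef_ge0 (R : realType) (n : nat) (P H : 'M[R]_n) :
  P^T = P -> (forall v : 'rV_n, v != 0 -> 0 < (v *m P *m v^T) 0 0) ->
  (forall v : 'rV_n, 0 <= \sum_i \sum_j v 0 i * v 0 j * H i j) ->
  0 <= \sum_i \sum_j P i j * H i j.
Proof.
move=> Psym Ppos Hpos.
have -> : \sum_i \sum_j P i j * H i j = \tr (P *m H^T).
  by apply: eq_bigr => i _; rewrite !mxE; apply: eq_bigr => j _; rewrite mxE.
apply: trace_posdef_ge0 => // v.
suff -> : (v *m H^T *m v^T) 0 0 = \sum_i \sum_j v 0 i * v 0 j * H i j.
  exact: Hpos.
rewrite mxE; apply: eq_bigr => i _; rewrite !mxE mulr_suml.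
by apply: eq_bigr => j _; rewrite mxE mulrAC (mulrC (v 0 j)).
Qed.

Lemma posdef_inverse (R : realType) (n : nat) (G : 'M[R]_n) :
  G^T = G -> (forall v : 'rV_n, v != 0 -> 0 < (v *m G *m v^T) 0 0) ->
  [/\ G \in unitmx, (invmx G)^T = invmx G &
      forall v : 'rV_n, v != 0 -> 0 < (v *m invmx G *m v^T) 0 0].
Proof.
move=> Gsym Gpos.
have Gu : G \in unitmx.
  rewrite unitmxE unitfE; apply/negP => /det0P[v v0 vG].
  by have := Gpos v v0; rewrite vG mul0mx mxE ltxx.
have invsym : (invmx G)^T = invmx G by rewrite trmx_inv Gsym.
split=> // v v0; set w := v *m invmx G.
have wG : w *m G = v by rewrite mulmxKV.
have w0 : w != 0 by apply: contra v0 => /eqP w0; rewrite -wG w0 mul0mx.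
have := Gpos w w0; rewrite wG /w trmx_mul invsym.
by rewrite mulmxA.
Qed.

(** * Continuity and compactness *)

Lemma continuous_cst_at (R : realType) (T : topologicalType) (k : R) (y : T) :
  {for y, continuous (fun=> k)}.
Proof. by apply: cvg_cst. Qed.

Lemma continuous_sum_at (R : realType) (T : topologicalType) (I : finType)
    (F : I -> T -> R) (y : T) :
  (forall i, {for y, continuous (F i)}) ->
  {for y, continuous (fun z => \sum_i F i z)}.
Proof. by move=> cF; apply: cvg_big => [|i _]; [exact: add_continuous|exact: cF]. Qed.

Lemma continuous_det_at (R : realType) (T : topologicalType) (n : nat)
    (G : T -> 'M[R]_n) (y : T) :
  (forall i j, {for y, continuous (fun z => G z i j)}) ->
  {for y, continuous (fun z => \det (G z))}.
Proof.
move=> cG; apply: continuous_sum_at => s.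
apply: continuousM; first exact: continuous_cst_at.
by apply: cvg_big => [|i _]; [exact: mul_continuous|exact: cG].
Qed.

Lemma continuous_adj_at (R : realType) (T : topologicalType) (n : nat)
    (G : T -> 'M[R]_n) (y : T) (i j : 'I_n) :
  (forall i j, {for y, continuous (fun z => G z i j)}) ->
  {for y, continuous (fun z => (\adj (G z)) i j)}.
Proof.
move=> cG.
have -> : (fun z => (\adj (G z)) i j)
  = (fun z => (-1) ^+ (j + i) * \det (row' j (col' i (G z)))).
  by apply/funext => z; rewrite mxE.
apply: continuousM; first exact: continuous_cst_at.
apply: continuous_det_at => k l.
have -> : (fun z => row' j (col' i (G z)) k l)
  = (fun z => G z (lift j k) (lift i l)).
  by apply/funext => z; rewrite !mxE.
exact: cG.
Qed.

Lemma continuous_subset_within (R : realType) (T : topologicalType)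
    (K : set T) (f : T -> R) :
  (forall y, K y -> {for y, continuous f}) -> {within K, continuous f}.
Proof.
by move=> cf; apply: continuous_in_subspaceT => y; rewrite inE; exact: cf.
Qed.

(** On the compact set, [q] is bounded below, and [max(q, 0) + s] is bounded
    below by a positive constant; so [s] is bounded away from 0 where
    [q <= 0]. *)
Lemma compact_penalization (R : realType) (T : topologicalType) (K : set T)
    (q s : T -> R) :
  compact K ->
  (forall y, K y -> {for y, continuous q}) ->
  (forall y, K y -> {for y, continuous s}) ->
  (forall y, K y -> 0 <= s y) ->
  (forall y, K y -> s y = 0 -> 0 < q y) ->
  exists L : R, forall y, K y -> 0 < q y + L * s y.
Proof.
move=> Kc cq cs s0 q0.
have [K0|/set0P Kn0] := eqVneq K set0; first by exists 0 => y; rewrite K0.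
have [y1 _ y1min] := compact_EVT_min Kn0 Kc (continuous_subset_within _ _ _ _ cq).
(* [q + |q|] is twice the positive part of [q]. *)
have cw y : K y -> {for y, continuous (fun z => (q z + `|q z|) + s z)}.
  move=> Ky; apply: (@continuousD _ _ _ (fun z => q z + `|q z|) s); last exact: cs.
  apply: (@continuousD _ _ _ q (fun z => `|q z|)); first exact: cq.
  by apply: continuous_comp; [exact: cq|exact: norm_continuous].
have [y2 Ky2 y2min] := compact_EVT_min Kn0 Kc (continuous_subset_within _ _ _ _ cw).
rewrite inE in Ky2.
set eta := q y2 + `|q y2| + s y2 in y2min.
have qq z : 0 <= q z + `|q z| by rewrite -lerBlDl sub0r -normrN ler_norm.
have eta0 : 0 < eta.
  rewrite lt_neqAle addr_ge0 ?s0// andbT eq_sym paddr_eq0 ?s0//.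
  apply/negP => /andP[/eqP E /eqP /(q0 _ Ky2) qpos].
  by move: E; rewrite gtr0_norm// => E; lra.
exists ((`|q y1| + 1) / eta) => y Ky.
have sy := s0 y Ky.
have [qy|qy] := ltP 0 (q y).
  by rewrite ltr_wpDr// mulr_ge0// divr_ge0 ?(ltW eta0)// addr_ge0.
have : eta <= s y.
  by have := y2min y; rewrite inE => /(_ Ky); rewrite ler0_norm// subrr add0r.
have : q y1 <= q y by apply: y1min; rewrite inE.
have : - q y1 <= `|q y1| by rewrite -normrN ler_norm.
move=> h1 h2 h3.
have : `|q y1| + 1 <= (`|q y1| + 1) / eta * s y.
  by rewrite -mulrA ler_peMr ?addr_ge0// mulrC ler_pdivlMr// mul1r.
lra.
Qed.

(** * The barrier *)

Section Barrier.
Context {R : realType} {n : nat}.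
Variables (p0 : 'rV[R]_n) (r : R).
Implicit Types y v : 'rV[R]_n.

Definition bump y : R := r ^+ 2 - \sum_i (y 0 i - p0 0 i) ^+ 2.

Lemma bump_line y v (t : R) :
  bump (y + t *: v) = bump y - 2 * t * (\sum_i (y 0 i - p0 0 i) * v 0 i)
                      - t ^+ 2 * \sum_i v 0 i ^+ 2.
Proof.
rewrite /bump -!addrA; congr (_ + _).
rewrite !mulr_sumr -!opprD -!big_split /=; congr (- _).
by apply: eq_bigr => i _; rewrite !mxE; ring.
Qed.

Lemma bump_continuous y : {for y, continuous bump}.
Proof.
apply: (@continuousB _ _ _ (fun=> r ^+ 2)); first exact: continuous_cst_at.
apply: continuous_sum_at => i.
have c1 : {for y, continuous (fun z : 'rV[R]_n => z 0 i - p0 0 i)}.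
  by apply: (@continuousB _ _ _ (fun z : 'rV[R]_n => z 0 i));
    [exact: coord_continuous | exact: continuous_cst_at].
exact: (continuousM c1 c1).
Qed.

Lemma bump_region_box y : 0 <= r -> 0 <= bump y ->
  forall i, `|y 0 i - p0 0 i| <= r.
Proof.
move=> r0; rewrite subr_ge0 => yr i.
rewrite -(@ler_sqr _ `|_|) ?nnegrE// real_normK ?num_real//.
apply: le_trans yr; rewrite (bigD1 i)//= lerDl.
by apply: sumr_ge0 => j _; exact: sqr_ge0.
Qed.

Lemma bump_region_compact : 0 <= r -> compact [set y | 0 <= bump y].
Proof.
move=> r0; pose box i := `[p0 0 i - r, p0 0 i + r]%classic.
apply: (@subclosed_compact _ _ [set v : 'rV[R]_n | forall i, box i (v 0 i)]).
- by apply: (@preimage_closed _ _ bump [set x | 0 <= x]);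
    [move=> y _; exact: bump_continuous | exact: closed_ge].
- by apply: (@rV_compact R n box) => i; exact: segment_compact.
- move=> y /(bump_region_box _ r0) yb i.
  by rewrite /box /= in_itv /= -ler_distl.
Qed.

(** With [bump_line], these two lemmas give the derivatives of the barrier
    [bump ^+ 2] along a line. *)
Lemma bump_sqr_derive1 (a b c t : R) :
  is_derive t 1 (fun s : R => (a - 2 * s * b - s ^+ 2 * c) ^+ 2)
   (- 4 * (a - 2 * t * b - t ^+ 2 * c) * (b + t * c)).
Proof.
apply: is_derive_eq; rewrite /GRing.scale /=; ring.
Qed.

Lemma bump_sqr_derive2 (a b c : R) :
  is_derive (0 : R) 1
    (fun t : R => - 4 * (a - 2 * t * b - t ^+ 2 * c) * (b + t * c))
    (8 * b ^+ 2 - 4 * a * c).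
Proof.
apply: is_derive_eq; rewrite /GRing.scale /=; ring.
Qed.

End Barrier.

(** * A bound on positive supersolutions *)

Lemma Ck_onW (R : realType) (n k : nat) (A : set 'rV[R]_n) (f : 'rV[R]_n -> R) :
  Ck_on k.+1 A f -> Ck_on k A f.
Proof.
elim: k f => [|k IH] f [cf f1]; split=> // i.
by have [df fi] := f1 i; split=> //; exact: IH.
Qed.

(** First- and second-order conditions at the point [q] where [mu * F] touches
    the barrier from above, tested on every line through [q]. *)
Lemma touching_conditions (R : realType) (n : nat) (A : set 'rV[R]_n)
    (p0 q : 'rV[R]_n) (r mu : R) (F : 'rV[R]_n -> R) :
  open A -> A q -> Ck_on 2 A F -> 0 < bump p0 r q ->
  (forall y, 0 <= bump p0 r y -> bump p0 r y ^+ 2 <= mu * F y) ->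
  bump p0 r q ^+ 2 = mu * F q ->
  let d k := q 0 k - p0 0 k in
  forall v : 'rV[R]_n,
    mu * \sum_k v 0 k * partial k F q
      = - 4 * bump p0 r q * \sum_k d k * v 0 k /\
    0 <= mu * \sum_j v 0 j * \sum_i v 0 i * partial i (partial j F) q
         - (8 * (\sum_k d k * v 0 k) ^+ 2
            - 4 * bump p0 r q * \sum_k v 0 k ^+ 2).
Proof.
move=> oA Aq F2 bq touch eqq d v.
set a := bump p0 r q in bq eqq *.
set b := \sum_k d k * v 0 k; set c := \sum_k v 0 k ^+ 2.
have toq : q + t *: v @[t --> (0 : R)] --> q.
  have : q + t *: v @[t --> (0 : R)] --> q + 0 *: v.
    by apply: cvgD; [exact: cvg_cst | apply: cvgZ; [exact: cvg_id | exact: cvg_cst]].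
  by rewrite scale0r addr0.
have lineE t : bump p0 r (q + t *: v) = a - 2 * t * b - t ^+ 2 * c.
  exact: bump_line.
pose f (t : R) : R := mu * F (q + t *: v) - bump p0 r (q + t *: v) ^+ 2.
pose df (t : R) : R := mu * (\sum_j v 0 j * partial j F (q + t *: v))
  - (- 4 * (a - 2 * t * b - t ^+ 2 * c) * (b + t * c)).
have fE : f = (mu \*: (fun t : R => F (q + t *: v)))
              - (fun t : R => (a - 2 * t * b - t ^+ 2 * c) ^+ 2).
  by apply/funext => t; rewrite /f lineE.
have dfE : df = (mu \*: (\sum_j (v 0 j \*: (fun t : R => partial j F (q + t *: v)))))
              - (fun t : R => - 4 * (a - 2 * t * b - t ^+ 2 * c) * (b + t * c)).
  by apply/funext => t; rewrite /df /= !fctE fct_sumE.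
have fdf : \forall t \near (0 : R), is_derive (t : R) 1 f (df t).
  have : \forall t \near (0 : R), A (q + t *: v).
    by apply: toq; exact: open_nbhs_nbhs.
  apply: filterS => t At; rewrite fE.
  apply: is_deriveB; last exact: bump_sqr_derive1.
  apply: is_deriveZ; apply: (is_derive_lineP _ _ F q v t _).1.
  by apply: C1_directional_derivative At; [|exact: Ck_onW].
have ddf : is_derive (0 : R) 1 df
    (mu * (\sum_j v 0 j * \sum_i v 0 i * partial i (partial j F) q)
     - (8 * b ^+ 2 - 4 * a * c)).
  rewrite dfE; apply: is_deriveB; last exact: bump_sqr_derive2.
  apply: is_deriveZ; apply: is_derive_sum => j; apply: is_deriveZ.
  apply: (is_derive_lineP _ _ (partial j F) q v 0 _).1.
  rewrite scale0r addr0.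
  by apply: C1_directional_derivative Aq; [|exact: (F2.2 j).2].
have fmin : \forall t \near (0 : R), f 0 <= f t.
  have : \forall t \near (0 : R), 0 < bump p0 r (q + t *: v).
    have cb : bump p0 r (q + t *: v) @[t --> (0 : R)] --> a.
      exact: (cvg_comp _ _ toq (bump_continuous p0 r q)).
    by move/cvgr_gt : cb; apply.
  apply: filterS => t bt.
  by rewrite /f scale0r addr0 eqq subrr subr_ge0 touch// ltW.
have [df0 d0] := second_derivative_test_min _ _ _ _ fdf ddf fmin.
split; last exact: d0.
move: df0; rewrite /df scale0r addr0 !(mulr0, mul0r) expr0n /= mul0r !subr0 addr0.
by move/eqP; rewrite subr_eq0 => /eqP.
Qed.

Lemma sum2_affine (R : realType) (n : nat) (w X Y : 'I_n -> 'I_n -> R)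
    (a b c : R) :
  \sum_i \sum_j w i j * (a * X i j - b * Y i j + c * (i == j)%:R)
  = a * (\sum_i \sum_j w i j * X i j) - b * (\sum_i \sum_j w i j * Y i j)
    + c * \sum_i w i i.
Proof.
rewrite !mulr_sumr -sumrB -big_split; apply: eq_bigr => i _ /=.
have -> : c * w i i = \sum_j c * (w i j * (i == j)%:R).
  rewrite (bigD1 i)//= eqxx mulr1 big1 ?addr0// => j ji.
  by rewrite eq_sym (negbTE ji) !mulr0.
rewrite !mulr_sumr -sumrB -big_split; apply: eq_bigr => j _ /=; ring.
Qed.

Lemma bump_region_in_open (R : realType) (n : nat) (A : set 'rV[R]_n)
    (p0 : 'rV[R]_n) :
  open A -> A p0 ->
  exists2 r : R, 0 < r & [set y | 0 <= bump p0 r y] `<=` A.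
Proof.
move=> oA Ap0.
have /nbhs_ballP[e /= e0 eA] : nbhs p0 A by exact: open_nbhs_nbhs.
exists (e / 2); first by rewrite divr_gt0.
move=> y /= yK; apply: eA; split=> // i j; rewrite (ord1 i) /ball /= distrC.
have e2 : 0 <= e / 2 by rewrite divr_ge0// ltW.
apply: le_lt_trans (bump_region_box _ _ _ e2 yK j) _.
by rewrite ltr_pdivrMr// ltr_pMr// ltr1n.
Qed.

(** The constant [L] is found before [F] is given: it only has to make
    [q + L * phi ^+ 2] positive on the closed ball [K], where [q] is the operator
    applied to the barrier [phi ^+ 2], minus [h] times the barrier.  The
    contact point of [F] with the barrier then shows
    [q + m * phi ^+ 2 <= 0] there. *)
Lemma positive_supersolution_bound (R : realType) (n : nat)
    (A : set 'rV[R]_n) (p0 : 'rV[R]_n) (P : 'rV[R]_n -> 'M[R]_n)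
    (b : 'I_n -> 'rV[R]_n -> R) (h : 'rV[R]_n -> R) :
  open A -> A p0 ->
  (forall y, A y -> (P y)^T = P y) ->
  (forall y, A y -> forall v : 'rV_n, v != 0 -> 0 < (v *m P y *m v^T) 0 0) ->
  (forall y, A y -> forall i j, {for y, continuous (fun z => P z i j)}) ->
  (forall y, A y -> forall k, {for y, continuous (b k)}) ->
  (forall y, A y -> {for y, continuous h}) ->
  exists L : R, forall (F : 'rV[R]_n -> R) (m : R),
    Ck_on 2 A F -> (forall y, A y -> 0 < F y) ->
    (forall y, A y ->
       \sum_i \sum_j P y i j * partial i (partial j F) y
       - \sum_k b k y * partial k F y <= (h y - m) * F y) ->
    m < L.
Proof.
move=> oA Ap0 Psym Ppos Pcont bcont hcont.
have [r r0 KA] := bump_region_in_open _ _ _ _ oA Ap0.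
pose phi := bump p0 r.
pose K := [set y | 0 <= phi y].
have Kc : compact K by apply: bump_region_compact; exact: ltW.
pose d k (y : 'rV[R]_n) := y 0 k - p0 0 k.
pose PHess y := \sum_i \sum_j P y i j * (d i y * d j y).
pose trP y := \sum_i P y i i.
pose drift y := \sum_k b k y * d k y.
pose q y := 8 * PHess y - phi y * (4 * trP y - 4 * drift y + h y * phi y).
have dcont k y : {for y, continuous (d k)}.
  apply: (@continuousB _ _ _ (fun z : 'rV[R]_n => z 0 k));
    [exact: coord_continuous | exact: continuous_cst_at].
have qcont y : K y -> {for y, continuous q}.
  move=> /KA Ay.
  have c1 : {for y, continuous PHess}.
    apply: continuous_sum_at => i; apply: continuous_sum_at => j.
    by apply: (continuousM (Pcont _ Ay i j)); exact: continuousM.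
  have c2 : {for y, continuous trP} by apply: continuous_sum_at => i; exact: Pcont.
  have c3 : {for y, continuous drift}.
    by apply: continuous_sum_at => i; apply: continuousM => //; exact: bcont.
  have c4 : {for y, continuous phi} by exact: bump_continuous.
  have cM (k : R) (f : 'rV[R]_n -> R) : {for y, continuous f} ->
      {for y, continuous (fun z => k * f z)}.
    by move=> cf; apply: continuousM => //; exact: continuous_cst_at.
  apply: (continuousB (cM _ _ c1)); apply: (continuousM c4).
  apply: (continuousD (continuousB (cM _ _ c2) (cM _ _ c3))).
  exact: (continuousM (hcont _ Ay) c4).
have phi2cont y : K y -> {for y, continuous (fun z => phi z ^+ 2)}.
  by move=> _; apply: (continuousM (bump_continuous p0 r y) (bump_continuous p0 r y)).
have PHessE y : PHess y = ((\row_k d k y) *m P y *m (\row_k d k y)^T) 0 0.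
  rewrite mxE /PHess exchange_big /=; apply: eq_bigr => j _.
  rewrite !mxE mulr_suml; apply: eq_bigr => i _; rewrite !mxE; ring.
(* On the sphere, [q] is eight times the principal part at the radial vector,
   which does not vanish. *)
have q_bdry y : K y -> phi y ^+ 2 = 0 -> 0 < q y.
  move=> Ky /eqP; rewrite sqrf_eq0 => /eqP phi0.
  rewrite /q phi0 mul0r subr0 mulr_gt0// PHessE Ppos//; first exact: KA.
  apply/eqP => dy0; move: phi0; rewrite /phi /bump big1 ?subr0.
    by move/eqP; rewrite sqrf_eq0 gt_eqF.
  move=> i _; have := congr1 (fun w : 'rV_n => w 0 i) dy0.
  by rewrite /= !mxE /d => ->; rewrite expr0n.
have [L qL] := compact_penalization _ _ _ _ _ Kc qcont phi2cont
  (fun y _ => sqr_ge0 (phi y)) q_bdry.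
exists L => F m F2 Fpos Fsuper.
have Kp0 : K p0.
  rewrite /K /phi /bump /= big1 ?subr0 ?sqr_ge0// => i _.
  by rewrite subrr expr0n.
have Fcont y : K y -> {for y, continuous F} by move=> /KA; exact: F2.1.
have ratio_cont y : K y -> {for y, continuous (fun z => phi z ^+ 2 / F z)}.
  move=> Ky; apply: (continuousM (phi2cont _ Ky)).
  by apply: continuousV; [rewrite gt_eqF// Fpos//; exact: KA | exact: Fcont].
have [x] := compact_EVT_max (ex_intro _ p0 Kp0) Kc
  (continuous_subset_within _ _ _ _ ratio_cont).
rewrite inE => Kx xmax; have Ax := KA _ Kx.
(* Maximising the quotient [phi ^+ 2 / F] yields the least multiple of [F] that
   lies above the barrier, and a point of contact. *)
pose mu := phi x ^+ 2 / F x.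
have touch y : K y -> phi y ^+ 2 <= mu * F y.
  move=> Ky; rewrite -ler_pdivrMr; first by apply: xmax; rewrite inE.
  by apply: Fpos; exact: KA.
have mu0 : 0 < mu.
  have : 0 < phi p0 ^+ 2.
    rewrite /phi /bump big1 ?subr0 ?exprn_gt0// => i _.
    by rewrite subrr expr0n.
  by move=> /lt_le_trans /(_ (touch _ Kp0)); rewrite pmulr_lgt0// Fpos//; exact: KA.
have eqx : phi x ^+ 2 = mu * F x by rewrite /mu divfK// gt_eqF// Fpos.
have phix : 0 < phi x.
  rewrite lt_neqAle Kx andbT eq_sym; apply/eqP => phi0.
  by move: mu0; rewrite /mu phi0 expr0n mul0r ltxx.
have touching := touching_conditions _ _ A p0 x r mu F oA Ax F2 phix touch eqx.
(* The gradient condition is recovered from the basis directions. *)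
have grad k : mu * partial k F x = - 4 * phi x * d k x.
  have [+ _] := touching (delta_mx 0 k).
  rewrite (bigD1 k)//= big1 ?addr0; last first.
    by move=> i ik; rewrite !mxE eqxx (negbTE ik) mul0r.
  rewrite [in RHS](bigD1 k)//= big1 ?addr0; last first.
    by move=> i ik; rewrite !mxE eqxx (negbTE ik) mulr0.
  by rewrite !mxE !eqxx mul1r mulr1.
(* [mu] times the Hessian of [F], minus the Hessian of the barrier. *)
pose H := \matrix_(i, j) (mu * partial i (partial j F) x
  - 8 * (d i x * d j x) + 4 * phi x * (i == j)%:R).
have Hpos (v : 'rV_n) : 0 <= \sum_i \sum_j v 0 i * v 0 j * H i j.
  have E1 : \sum_j v 0 j * \sum_i v 0 i * partial i (partial j F) x
      = \sum_i \sum_j v 0 i * v 0 j * partial i (partial j F) x.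
    rewrite exchange_big /=; apply: eq_bigr => j _.
    by rewrite mulr_sumr; apply: eq_bigr => i _; ring.
  have E2 : (\sum_k d k x * v 0 k) ^+ 2
      = \sum_i \sum_j v 0 i * v 0 j * (d i x * d j x).
    rewrite expr2 mulr_suml; apply: eq_bigr => i _.
    by rewrite mulr_sumr; apply: eq_bigr => j _; ring.
  have E3 : \sum_k v 0 k ^+ 2 = \sum_i v 0 i * v 0 i by [].
  have -> : \sum_i \sum_j v 0 i * v 0 j * H i j
      = mu * (\sum_j v 0 j * \sum_i v 0 i * partial i (partial j F) x)
        - 8 * (\sum_k d k x * v 0 k) ^+ 2 + 4 * phi x * \sum_k v 0 k ^+ 2.
    rewrite E1 E2 E3 -sum2_affine.
    by apply: eq_bigr => i _; apply: eq_bigr => j _; rewrite mxE.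
  have [_] := touching v; rewrite -/phi; lra.
have := contraction_posdef_ge0 _ _ _ _ (Psym _ Ax) (Ppos _ Ax) Hpos.
have -> : \sum_i \sum_j P x i j * H i j
  = mu * (\sum_i \sum_j P x i j * partial i (partial j F) x)
    - 8 * PHess x + 4 * phi x * trP x.
  by rewrite -sum2_affine; apply: eq_bigr => i _; apply: eq_bigr => j _; rewrite mxE.
have driftE : mu * (\sum_k b k x * partial k F x) = - 4 * phi x * drift x.
  rewrite !mulr_sumr; apply: eq_bigr => k _.
  by rewrite mulrCA grad; ring.
have := Fsuper _ Ax; rewrite -(ler_pM2l mu0) mulrBr driftE => Fx.
have Ex : mu * ((h x - m) * F x) = (h x - m) * phi x ^+ 2 by rewrite eqx; ring.
move=> trace_ge0; have := qL _ Kx; rewrite /q => qLx.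
have : 0 < (L - m) * phi x ^+ 2 by rewrite Ex in Fx; lra.
by rewrite pmulr_lgt0 ?exprn_gt0// subr_gt0.
Qed.

(** * The infimum of a solution *)

Lemma metric_posdef (R : realType) (n : nat) (M : manifold R n) (g : metric M)
    (c : chart R n M) (y : 'rV[R]_n) :
  atlas c -> cimg c y ->
  [/\ gmx g c y \in unitmx, (ginv g c y)^T = ginv g c y &
      forall v : 'rV_n, v != 0 -> 0 < (v *m ginv g c y *m v^T) 0 0].
Proof.
move=> ac cy; apply: posdef_inverse; first exact: gmx_sym.
exact: gmx_pos.
Qed.

(** Cramer's formula expresses the inverse by determinants; it is valid only
    where the matrix is invertible, hence on the image of the chart. *)
Lemma continuous_ginv (R : realType) (n : nat) (M : manifold R n) (g : metric M)
    (c : chart R n M) (y : 'rV[R]_n) (i j : 'I_n) :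
  atlas c -> cimg c y -> {for y, continuous (fun z => ginv g c z i j)}.
Proof.
move=> ac cy.
have cG k l : {for y, continuous (fun z => gmx g c z k l)}.
  exact: (gmx_smooth g ac k l 0).1.
pose inv z := (\det (gmx g c z))^-1 * (\adj (gmx g c z)) i j.
have invE z : cimg c z -> inv z = ginv g c z i j.
  move=> cz; have [Gu _ _] := metric_posdef _ _ _ g c z ac cz.
  by rewrite /ginv /invmx Gu mxE.
have cinv_y : {for y, continuous inv}.
  have [Gu _ _] := metric_posdef _ _ _ g c y ac cy.
  apply: continuousM; last exact: continuous_adj_at.
  apply: continuousV; last exact: continuous_det_at.
  by rewrite -unitfE -unitmxE.
rewrite /prop_for /continuous_at -invE//.
have nb : nbhs y (cimg c).
  exact: (open_nbhs_nbhs (conj (@cimg_open _ _ _ c) cy)).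
apply: cvg_trans cinv_y; apply: (@near_eq_cvg _ _ (nbhs y)).
near=> z; apply: invE; near: z; exact: nb.
Unshelve. all: by end_near. Qed.

Lemma continuous_christoffel (R : realType) (n : nat) (M : manifold R n)
    (g : metric M) (c : chart R n M) (y : 'rV[R]_n) (k i j : 'I_n) :
  atlas c -> cimg c y ->
  {for y, continuous (fun z => christoffel g c z k i j)}.
Proof.
move=> ac cy.
have dG m s t : {for y, continuous (partial m (fun z => gmx g c z s t))}.
  exact: ((gmx_smooth g ac s t 1).2 m).2.1.
apply: continuousM; first exact: continuous_cst_at.
apply: continuous_sum_at => l.
apply: continuousM; first exact: continuous_ginv.
by apply: continuousB => //; exact: continuousD.
Qed.

Lemma laplacianE (R : realType) (n : nat) (M : manifold R n) (g : metric M)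
    (c : chart R n M) (f : M -> R) (y : 'rV[R]_n) :
  cimg c y ->
  laplacian g c f (cinv c y)
  = - (\sum_i \sum_j ginv g c y i j * partial i (partial j (f \o cinv c)) y
       - \sum_k (\sum_i \sum_j ginv g c y i j * christoffel g c y k i j)
                * partial k (f \o cinv c) y).
Proof.
move=> cy; rewrite /laplacian cinvK//; congr (- _).
have distr (p x : R) (G d : 'I_n -> R) :
    p * (x - \sum_k G k * d k) = p * x - \sum_k p * G k * d k.
  by rewrite mulrBr mulr_sumr; under eq_bigr do rewrite mulrA.
have -> : \sum_k (\sum_i \sum_j ginv g c y i j * christoffel g c y k i j)
                 * partial k (f \o cinv c) y
    = \sum_i \sum_j \sum_k ginv g c y i j * christoffel g c y k i j
                           * partial k (f \o cinv c) y.
  under eq_bigr do rewrite mulr_suml.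
  rewrite exchange_big /=; apply: eq_bigr => i _.
  under eq_bigr do rewrite mulr_suml.
  by rewrite exchange_big.
rewrite -sumrB; apply: eq_bigr => i _; rewrite -sumrB; apply: eq_bigr => j _.
exact: distr.
Qed.

(** The linear operator in the chart at [x0] does not involve [u]: the
    nonlinearity enters only through
    [V * u ^ ((n+2)/(n-2)) >= a * inf u ^ (4/(n-2)) * u], so the bound on
    supersolutions limits [inf u]. *)
Lemma inf_solution_bounded (R : realType) (n : nat) (M : manifold R n)
    (g : metric M) (h V : M -> R) (a : R) (x0 : M) :
  (2 < n)%N -> smooth_fun h -> 0 < a -> (forall x, a <= V x) ->
  exists C : R, forall u : M -> R, regular_solution g h V u -> inf_all u <= C.
Proof.
move=> n2 hh a0 hV.
have n20 : 0 < n%:R - 2 :> R by rewrite subr_gt0 ltr_nat.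
have [c ac cx0] := atlas_cover x0.
pose A := cimg c.
have [L Lbound] : exists L : R, forall (F : 'rV[R]_n -> R) (m : R),
    Ck_on 2 A F -> (forall y, A y -> 0 < F y) ->
    (forall y, A y ->
       \sum_i \sum_j ginv g c y i j * partial i (partial j F) y
       - \sum_k (\sum_i \sum_j ginv g c y i j * christoffel g c y k i j)
                 * partial k F y <= (h (cinv c y) - m) * F y) ->
    m < L.
  apply: (positive_supersolution_bound _ _ A (cmap c x0) (ginv g c) _
            (h \o cinv c)).
  - exact: cimg_open.
  - exact: cmap_img.
  - by move=> y Ay; have [] := metric_posdef _ _ _ g c y ac Ay.
  - by move=> y Ay; have [] := metric_posdef _ _ _ g c y ac Ay.
  - by move=> y Ay i j; exact: continuous_ginv.
  - move=> y Ay k; apply: continuous_sum_at => i; apply: continuous_sum_at => j.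
    by apply: continuousM; [exact: continuous_ginv | exact: continuous_christoffel].
  - exact: (hh 0 c ac).1.
pose s : R := 4 / (n%:R - 2).
have s0 : 0 < s by rewrite divr_gt0.
have pE : (n%:R + 2) / (n%:R - 2) = 1 + s :> R.
  by rewrite /s; field; rewrite gt_eqF.
exists ((`|L| / a) `^ s^-1) => u [u2 upos ueq].
set m := inf_all u; rewrite leNgt; apply/negP => mbig.
have m0 : 0 <= m by apply: ltW; apply: le_lt_trans mbig; exact: powR_ge0.
have mu x : m <= u x.
  by apply: ge_inf; [exists 0 => _ [z _ <-]; exact: ltW | exists x].
suff : a * m `^ s < L.
  apply/negP; rewrite -leNgt (le_trans (ler_norm L))//.
  rewrite mulrC -ler_pdivrMr//.
  have -> : `|L| / a = ((`|L| / a) `^ s^-1) `^ s.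
    by rewrite -powRrM mulVf ?gt_eqF// powRr1// divr_ge0// ltW.
  by apply: ge0_ler_powR; rewrite ?nnegrE ?powR_ge0// ltW.
apply: (Lbound (u \o cinv c)); first exact: u2.
  by move=> y _; exact: upos.
move=> y Ay; pose x := cinv c y.
have := ueq c x ac (cinv_dom Ay); rewrite laplacianE// pE powRD; last first.
  by apply/implyP => _; rewrite gt_eqF// upos.
rewrite powRr1 ?(ltW (upos _))// => E.
have lower : a * m `^ s * u x <= V x * (u x * u x `^ s).
  rewrite [leRHS]mulrCA [leRHS]mulrC ler_wpM2r ?(ltW (upos _))//.
  apply: ler_pM; [exact: ltW | exact: powR_ge0 | exact: hV |].
  by apply: ge0_ler_powR; rewrite ?nnegrE// ltW.
set D := (X in X <= _); move: E; rewrite -/D -/x => E.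
have -> : D = h x * u x - V x * (u x * u x `^ s) by rewrite -E opprD opprK addrCA subrr addr0.
by rewrite mulrBl lerB.
Qed.

(** * The dichotomy *)

Lemma esup_cvgy_of_no_bounded_subsequence (R : realType) (T : Type)
    (K : set T) (u : nat -> T -> R) :
  (~ exists (i : nat -> nat) (C : R),
     [/\ {homo i : j l / (j < l)%N}, 0 < C &
         forall j, (esup_on K (u (i j)) <= C%:E)%E]) ->
  esup_on K (u k) @[k --> \oo] --> +oo%E.
Proof.
move=> unbounded; apply/cvgeyPge => C.
apply: contrapT => not_eventually; apply: unbounded.
have often N : exists k, (N <= k)%N /\ (esup_on K (u k) <= C%:E)%E.
  apply: contrapT => large; apply: not_eventually; exists N => // k /= Nk.
  by rewrite leNgt; apply/negP => /ltW kC; apply: large; exists k.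
have [next nextP] := choice often.
exists (fun j => iter j (next \o succn) (next 0%N)), (Num.max 1 C).
split; first 1 last.
- by rewrite lt_max ltr01.
- move=> j; apply: (@le_trans _ _ C%:E); last by rewrite lee_fin le_max lexx orbT.
  by case: j => [|j] /=; exact: (nextP _).2.
- apply: homo_ltn; first exact: ltn_trans.
  by move=> j /=; exact: (nextP _).1.
Qed.

(** For a given value [t] of the ratio, only finitely many indices matter, by
    the bound on the infima.  An infinite supremum is read as 0 by
    [sup_on], and then the left-hand side is at most 1. *)
Lemma sup_bounded_by_ratio (R : realType) (T : Type) (KK : set (set T))
    (u : nat -> T -> R) (C e : R) :
  0 < e ->
  (forall K k, KK K -> inf_all (u k) <= C) ->
  (forall K, KK K -> esup_on K (u k) @[k --> \oo] --> +oo%E) ->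
  exists c : R -> set T -> R,
    (forall t K, 0 < c t K) /\
    forall K k, KK K -> 0 < inf_all (u k) ->
      sup_on K (u k) `^ (1 - e)
      <= c (inf_all (u k) / sup_on K (u k) `^ e) K.
Proof.
move=> e0 infC supy.
(* The pointwise bounds are collected into the function [c] by choice. *)
have bounded (tK : R * set T) : exists D : R, 0 < D /\
    (KK tK.2 -> forall k, 0 < inf_all (u k) ->
     inf_all (u k) / sup_on tK.2 (u k) `^ e = tK.1 ->
     sup_on tK.2 (u k) `^ (1 - e) <= D).
  case: tK => t K /=.
  have [KKK|nK] := pselect (KK K); last by exists 1; split.
  pose B := (C / t) `^ e^-1.
  have [N _ NB] := (cvgeyPge _).1 (supy K KKK) (B + 1).
  (* The summand 1 covers the indices with infinite supremum, the sum covers the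
   finitely many indices below [N]. *)
pose D := 1 + \sum_(k < N) sup_on K (u k) `^ (1 - e).
  exists D; split.
    by rewrite ltr_pwDl// sumr_ge0// => k _; exact: powR_ge0.
  move=> _ k I0 It.
  have [kN|Nk] := ltnP k N.
    rewrite /D (bigD1 (Ordinal kN))//= addrCA lerDl addr_ge0//.
    by rewrite sumr_ge0// => j _; exact: powR_ge0.
  suff -> : sup_on K (u k) = 0.
    apply: (@le_trans _ _ 1); last by rewrite lerDl sumr_ge0// => j _; exact: powR_ge0.
    by rewrite /powR eqxx; case: (_ == _) => /=; rewrite ?ler01.
  have := NB k Nk; rewrite /sup_on in It *.
  case: (esup_on K (u k)) It => [S|//|//] /= It; rewrite lee_fin => BS.
  have B0 : 0 <= B by exact: powR_ge0.
  have S0 : 0 < S by lra.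
  have Se0 : 0 < S `^ e by exact: powR_gt0.
  have t0 : 0 < t by rewrite -It divr_gt0.
  have SeE : S `^ e = inf_all (u k) / t by rewrite -It invf_div mulrCA mulfV ?mulr1 ?gt_eqF.
  have : S <= B.
    have -> : S = (S `^ e) `^ e^-1.
      by rewrite -powRrM mulfV ?gt_eqF// powRr1// ltW.
    rewrite /B; apply: ge0_ler_powR; rewrite ?nnegrE ?invr_ge0 ?(ltW e0) ?(ltW Se0)//.
      by rewrite divr_ge0 ?(ltW t0)// (le_trans (ltW I0))// (infC K).
    by rewrite SeE ler_pM2r ?invr_gt0// (infC K).
  lra.
have [c cP] := choice bounded.
exists (fun t K => c (t, K)); split=> [t K|K k KKK I0]; first exact: (cP (t, K)).1.
exact: (cP (_, K)).2.
Qed.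

Theorem theorem1p1 (R : realType) (n : nat) (M : manifold R n) (g : metric M)
    (h V : M -> R) (a b A : R) (u : nat -> M -> R) (KK : set (set M))
    (hn : (4 <= n)%N)
    (hh : smooth_fun h)
    (ha : 0 < a)
    (hV : forall x, a <= V x <= b)
    (hVlip : lipschitz_fun g V)
    (hVgrad : gradient_bounded g A V)
    (hu : forall k, regular_solution g h V (u k))
    (hKK : KK = compact_family M \/ exists x0 : M, KK = ball_family g x0) :
  (exists K0 (i : nat -> nat) (C : R),
     [/\ KK K0, {homo i : j l / (j < l)%N}, 0 < C &
         forall j, (esup_on K0 (u (i j)) <= C%:E)%E])
  \/
  [/\ forall K, KK K -> esup_on K (u k) @[k --> \oo] --> +oo%E,
      n = 4%N ->
        forall e : R, 0 < e ->
        exists c : R -> set M -> R,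
          (forall t K, 0 < t -> KK K -> 0 < c t K) /\
          forall K k, KK K -> 0 < inf_all (u k) ->
            sup_on K (u k) `^ (1 - e)
            <= c (inf_all (u k) / sup_on K (u k) `^ e) K
    & (5 <= n)%N ->
        forall e : R, (n%:R - 4) / (n%:R - 2) < e ->
        exists c : R -> set M -> R,
          (forall t K, 0 < t -> KK K -> 0 < c t K) /\
          forall K, KK K ->
            exists2 eps : nat -> R, (forall k, 0 < eps k <= 1) &
            forall k, 0 < inf_all (u k) ->
              sup_on K (u k) `^ (1 - e)
              <= eps k `^ (1 - e)
                 * c (eps k `^ e * (inf_all (u k) / sup_on K (u k) `^ e)) K].
Proof.
have [bounded|unbounded] := pselect (exists K0 (i : nat -> nat) (C : R),
  [/\ KK K0, {homo i : j l / (j < l)%N}, 0 < C &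
      forall j, (esup_on K0 (u (i j)) <= C%:E)%E]); first by left.
right.
have supy K : KK K -> esup_on K (u k) @[k --> \oo] --> +oo%E.
  move=> KKK; apply: esup_cvgy_of_no_bounded_subsequence => -[i [C [hi C0 iC]]].
  by apply: unbounded; exists K, i, C.
have [C infC] : exists C : R, forall K k, KK K -> inf_all (u k) <= C.
  have point K : KK K -> exists x : M, True.
    by case: hKK => [->[_ [x _]]|[x _] _]; exists x.
  have [[x _]|noM] := pselect (exists x : M, True); last first.
    by exists 0 => K k /point.
  have aV y : a <= V y by case/andP: (hV y).
  have [C uC] := inf_solution_bounded R n M g h V a x (ltnW hn) hh ha aV.
  by exists C => K k _; exact: uC.
split=> // [_ e e0|n5 e ne].
  have [c [c0 cP]] := sup_bounded_by_ratio R M KK u C e e0 infC supy.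
  by exists c; split.
have e0 : 0 < e.
  apply: le_lt_trans ne; rewrite divr_ge0// subr_ge0 ler_nat//.
  by apply: leq_trans hn.
have [c [c0 cP]] := sup_bounded_by_ratio R M KK u C e e0 infC supy.
exists c; split=> // K KKK; exists (cst 1) => [k|k I0] /=.
  by rewrite ltr01 lexx.
by rewrite !powR1 !mul1r; exact: cP.
Qed.
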